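(* Let $M$ be a smooth manifold and let $g,\tilde g$ be two almost compatible (pseudo-Riemannian) metrics on $M$, with Levi-Civita connections $\nabla,\tilde\nabla$. The following statements are equivalent: 1. The metrics $g$ and $\tilde g$ are compatible. 2. For every $\alpha,\beta\in\mathcal{E}^{1}(M)$ and $X,Y\in\mathcal{X}(M)$, $$g^{*}(\tilde\nabla_{Y}\alpha-\nabla_{Y}\alpha,\ \tilde\nabla_{X}\beta-\nabla_{X}\beta)=g^{*}(\tilde\nabla_{X}\alpha-\nabla_{X}\alpha,\ \tilde\nabla_{Y}\beta-\nabla_{Y}\beta).$$ 3. For every $\alpha,\beta\in\mathcal{E}^{1}(M)$ and $X,Y\in\mathcal{X}(M)$, $$\tilde g^{*}(\tilde\nabla_{Y}\alpha-\nabla_{Y}\alpha,\ \tilde\nabla_{X}\beta-\nabla_{X}\beta)=\tilde g^{*}(\tilde\nabla_{X}\alpha-\nabla_{X}\alpha,\ \tilde\nabla_{Y}\beta-\nabla_{Y}\beta).$$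
   Context: $\mathcal{X}(M)$ denotes the smooth vector fields and $\mathcal{E}^1(M)$ the smooth $1$-forms on $M$. ''Metric'' means pseudo-Riemannian metric. For a metric $g$, $g^*$ denotes the induced metric on $T^*M$; also $g(X)$ denotes the $1$-form $g(X,\cdot)$ and $g^*\alpha$ the vector field corresponding to the $1$-form $\alpha$ under $TM\cong T^*M$. Levi-Civita connections $\nabla$ of $g$ and $\tilde\nabla$ of $\tilde g$ are also used for the induced connections on $T^*M$; $R,\tilde R$ are the curvatures, $R_{X,Y}=\nabla_X\nabla_Y-\nabla_Y\nabla_X-\nabla_{[X,Y]}$ (acting here on $1$-forms). For every constant $\lambda$ put $g_\lambda^*:=g^*+\lambda\tilde g^*$; it is a standing assumption that $g_\lambda^*$ is non-degenerate for every constant $\lambda$. $g_\lambda$ is the corresponding metric, with Levi-Civita connection $\nabla^\lambda$ and curvature $R^\lambda$. $g,\tilde g$ are almost compatible if $g_\lambda^*\nabla^\lambda_X\alpha=g^*\nabla_X\alpha+\lambda\tilde g^*\tilde\nabla_X\alpha$ for all $X\in\mathcal{X}(M)$, $\alpha\in\mathcal{E}^1(M)$ and constants $\lambda$. They are compatible if they are almost compatible and moreover $g_\lambda^*(R^\lambda_{X,Y}\alpha)=g^*(R_{X,Y}\alpha)+\lambda\tilde g^*(\tilde R_{X,Y}\alpha)$ for all $\alpha\in\mathcal{E}^1(M)$, $X,Y\in\mathcal{X}(M)$ and constants $\lambda$. *)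

(* Defs.v *)
From mathcomp Require Export all_boot all_order all_algebra.
From mathcomp Require Export all_classical all_reals all_analysis.
Export numFieldNormedType.Exports.
Set Implicit Arguments.
Unset Strict Implicit.
Unset Printing Implicit Defensive.
Import Order.TTheory GRing.Theory Num.Theory.
Local Open Scope classical_set_scope.
Local Open Scope ring_scope.

(** * Smooth maps on open subsets of R^n *)

Fixpoint Ck {R : realType} {n : nat} {W : normedModType R} (k : nat)
    (U : set 'rV[R]_n) (f : 'rV[R]_n -> W) : Prop :=
  match k with
  | 0 => forall x, U x -> {for x, continuous f}
  | k'.+1 => (forall x, U x -> differentiable f x) /\
             forall i : 'I_n, Ck k' U ('D_(delta_mx 0 i) f)
  end.

Definition smooth {R : realType} {n : nat} {W : normedModType R}
    (U : set 'rV[R]_n) (f : 'rV[R]_n -> W) : Prop :=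
  forall k, Ck k U f.

(** * Smooth manifolds *)

(* The atlas need not be maximal. [phi i] and [psi i] are total functions, but
   only their restrictions to [dom i] and [cod i] matter. [chart_at] picks a
   chart around each point, so the domains cover the manifold. *)
Record smooth_manifold (R : realType) (n : nat) := SmoothManifold {
  carrier :> topologicalType ;
  chart : Type ;
  dom : chart -> set carrier ;
  cod : chart -> set 'rV[R]_n ;
  phi : chart -> carrier -> 'rV[R]_n ;
  psi : chart -> 'rV[R]_n -> carrier ;
  chart_at : carrier -> chart ;
  manifold_hausdorff : hausdorff_space carrier ;
  manifold_second_countable : second_countable (T := carrier) ;
  dom_open : forall i, open (dom i) ;
  cod_open : forall i, open (cod i) ;
  phi_cod : forall i p, dom i p -> cod i (phi i p) ;
  psi_dom : forall i x, cod i x -> dom i (psi i x) ;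
  phiK : forall i p, dom i p -> psi i (phi i p) = p ;
  psiK : forall i x, cod i x -> phi i (psi i x) = x ;
  phi_continuous : forall i, {within dom i, continuous (phi i)} ;
  psi_continuous : forall i, {within cod i, continuous (psi i)} ;
  dom_chart_at : forall p, dom (chart_at p) p ;
  transition_smooth : forall i j,
    smooth (cod i `&` psi i @^-1` dom j) (phi j \o psi i) }.

(* Tensor fields are given by their components in each chart, subject to
   smoothness and to the transformation law. Components of vector fields and
   1-forms are normalized to be 0 outside the domain of the chart, so that
   equality of sections is [=]. *)
Definition section {R : realType} {n : nat} (M : smooth_manifold R n) :=
  chart M -> M -> 'rV[R]_n.
Definition section2 {R : realType} {n : nat} (M : smooth_manifold R n) :=
  chart M -> M -> 'M[R]_n.

Section Tensors.
Context {R : realType} {n : nat} {M : smooth_manifold R n}.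

Definition smooth_fun (f : M -> R) : Prop :=
  forall i : chart M, smooth (cod i) (f \o psi i).

(* Entry (k, l) is the derivative of the l-th coordinate of the chart j with
   respect to the k-th coordinate of the chart i. *)
Definition jac (i j : chart M) (p : M) : 'M[R]_n :=
  jacobian (phi j \o psi i) (phi i p).

Definition vector_field (X : section M) : Prop :=
  [/\ forall i, smooth (cod i) (X i \o psi i),
      forall i j p, dom i p -> dom j p -> X j p = X i p *m jac i j p &
      forall i p, ~ dom i p -> X i p = 0].

Definition one_form (a : section M) : Prop :=
  [/\ forall i, smooth (cod i) (a i \o psi i),
      forall i j p, dom i p -> dom j p -> a i p = a j p *m (jac i j p)^T &
      forall i p, ~ dom i p -> a i p = 0].

Definition nondegenerate (h : section2 M) : Prop :=
  forall i p, dom i p -> h i p \in unitmx.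

Definition metric (g : section2 M) : Prop :=
  [/\ forall i, smooth (cod i) (g i \o psi i),
      forall i j p, dom i p -> dom j p ->
        g i p = jac i j p *m g j p *m (jac i j p)^T,
      forall i p, dom i p -> (g i p)^T = g i p &
      nondegenerate g].

Definition contract (a X : section M) : M -> R :=
  fun p => (a (chart_at p) p *m (X (chart_at p) p)^T) 0 0.

(* The value on a pair of vector fields of a form on TM, or on a pair of 1-forms
   of a form on T*M. *)
Definition form2 (h : section2 M) (u v : section M) : M -> R :=
  fun p => let i := chart_at p in (u i p *m h i p *m (v i p)^T) 0 0.

(* The form on T*M induced by a metric; conversely, the metric induced by a
   non-degenerate form on T*M. *)
Definition dual (h : section2 M) : section2 M := fun i p => invmx (h i p).

(* For [h] a symmetric form on T*M, the vector field corresponding to the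
   1-form [a]. *)
Definition sharp (h : section2 M) (a : section M) : section M :=
  fun i p => a i p *m h i p.

Definition scale (f : M -> R) (X : section M) : section M :=
  fun i p => f p *: X i p.

Definition act (X : section M) (f : M -> R) : M -> R :=
  fun p => let i := chart_at p in 'D_(X i p) (f \o psi i) (phi i p).

Definition lie_bracket (X Y : section M) : section M := fun i p =>
  'D_(X i p) (Y i \o psi i) (phi i p) - 'D_(Y i p) (X i \o psi i) (phi i p).

(** * Connections *)

Definition connection (D : section M -> section M -> section M) : Prop :=
  [/\ forall X Y, vector_field X -> vector_field Y -> vector_field (D X Y),
      forall X Y Z, vector_field X -> vector_field Y -> vector_field Z ->
        D (X + Y) Z = D X Z + D Y Z /\ D X (Y + Z) = D X Y + D X Z,
      forall f X Y, smooth_fun f -> vector_field X -> vector_field Y ->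
        D (scale f X) Y = scale f (D X Y) &
      forall f X Y, smooth_fun f -> vector_field X -> vector_field Y ->
        D X (scale f Y) = scale (act X f) Y + scale f (D X Y)].

Definition levi_civita (g : section2 M)
    (D : section M -> section M -> section M) : Prop :=
  [/\ connection D,
      forall X Y, vector_field X -> vector_field Y ->
        D X Y - D Y X = lie_bracket X Y &
      forall X Y Z, vector_field X -> vector_field Y -> vector_field Z ->
        act X (form2 g Y Z) = form2 g (D X Y) Z + form2 g Y (D X Z)].

(* The induced connection on T*M: the unique 1-form with the stated values. *)
Definition induced (D : section M -> section M -> section M)
    (X a : section M) : section M :=
  xget 0 [set b : section M | one_form b /\
    forall Y, vector_field Y ->
      contract b Y = act X (contract a Y) - contract a (D X Y)].

Definition curvature (D : section M -> section M -> section M)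
    (X Y a : section M) : section M :=
  induced D X (induced D Y a) - induced D Y (induced D X a)
  - induced D (lie_bracket X Y) a.

(** * Compatibility *)

Definition pencil (g g' : section2 M) (l : R) : section2 M :=
  dual g + l *: dual g'.

(* [D], [D'] and [Dl l] stand for the Levi-Civita connections of [g], [g'] and
   of the metric [dual (pencil g g' l)]. *)
Definition almost_compatible (g g' : section2 M)
    (D D' : section M -> section M -> section M)
    (Dl : R -> section M -> section M -> section M) : Prop :=
  forall (l : R) X a, vector_field X -> one_form a ->
    sharp (pencil g g' l) (induced (Dl l) X a) =
    sharp (dual g) (induced D X a) + l *: sharp (dual g') (induced D' X a).

Definition compatible (g g' : section2 M)
    (D D' : section M -> section M -> section M)
    (Dl : R -> section M -> section M -> section M) : Prop :=
  almost_compatible g g' D D' Dl /\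
  forall (l : R) X Y a, vector_field X -> vector_field Y -> one_form a ->
    sharp (pencil g g' l) (curvature (Dl l) X Y a) =
    sharp (dual g) (curvature D X Y a) +
    l *: sharp (dual g') (curvature D' X Y a).

End Tensors.

(* Main.v *)
Require Import Defs.
From mathcomp Require Import ring lra.
Set Implicit Arguments.
Unset Strict Implicit.
Unset Printing Implicit Defensive.
Import Order.TTheory GRing.Theory Num.Theory.
Local Open Scope classical_set_scope.
Local Open Scope ring_scope.

(** Write A and B for the maps from 1-forms to vector fields given by the two
    metrics on T*M, C = A + l B for the one given by the pencil, F for the
    inverse of C, and K_X = N'_X - N_X for the difference of the two induced
    connections on 1-forms. Since components are row vectors, the pairing of a
    1-form with a vector field is a symmetric dot product ([contractC]), for
    which A, B and F are self-adjoint ([contract_sharp]).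

    Almost compatibility says that the induced connection N^l of the pencil is
    N + F l B K, or equivalently N' - F A K ([induced_pencil_g],
    [induced_pencil_g']). Moreover A N_X = D_X A because g is parallel
    ([sharp_induced]). Expanding C N^l_X N^l_Y with the first form of N^l
    under A and the second one under B, and using A F l B = l B F A, no
    derivative of the metrics survives, and the failure of the curvature
    identity is (D_X - D'_X) Z_Y - (D_Y - D'_Y) Z_X with Z_Y = A F l B K_Y a
    ([curvature_defect]). As D - D' is the transpose of K, compatibility means
    that the pairing of K_X b with A F l B K_Y a is symmetric in X and Y, for
    every l ([compatibleP]).

    It remains to compare this with the same symmetry for A and for B in place
    of A F l B. All connections involved are torsion-free, so the pairing of
    K_X a with Y is symmetric in X and Y, and so are those of F l B K_X a and
    F A K_X a with Y. Hence these operators can be moved onto the index: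
    F l B K_X = K_(l B F X), F A K_X = K_(A F X), and B K_X = A K_(B A^-1 X)
    ([difference_pencil_g'], [difference_pencil_g], [sharp_difference]). Each
    of the three implications is then a substitution in X or Y; in the first
    one l = 1 suffices, because B F is invertible, so that no limit in l is
    taken.

    All of this takes place between global sections, and equalities of sections
    are deduced from equalities of pairings ([vector_field_eq], [one_form_eq]),
    which requires enough global sections. They are provided by the
    differentials of bump functions exp (-1 / (r^2 - |x - c|^2)) in a chart: the
    gradient at a point x of the ball is a positive multiple of c - x, so moving
    the centre c gives every direction ([one_form_delta]). *)

(** * Calculus of C^k maps *)

Section Calculus.
Context {R : realType} {n : nat}.
Implicit Types (U : set 'rV[R]_n) (W : normedModType R).

Lemma near0_differentiable {V W : normedModType R} (u : V -> W) x :
  (\near x, u x = 0) -> differentiable u x.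
Proof.
move=> u0; have o0 : u \o shift x = cst (u x) + \0 +o_ 0 id.
  apply/eqaddoP => _/posnumP[e]; rewrite (nbhs_singleton u0).
  have : \forall y \near 0, u (y + x) = 0.
    by move: u0; rewrite [X in X -> _](near_shift 0) subr0.
  apply: filterS => y uy; rewrite !fctE /=.
  by rewrite uy addr0 subr0 normr0 mulr_ge0.
have c0 : continuous (\0 : V -> W) by exact: cst_continuous.
have d0 := diff_unique c0 o0.
by apply/diff_locallyP; rewrite d0.
Qed.

(** Differentiability is a local property: the difference of the two functions
    vanishes near the point, and so has differential 0 there. *)
Lemma near_eq_differentiable {V W : normedModType R} (f h : V -> W) x :
  (\near x, f x = h x) -> differentiable f x -> differentiable h x.
Proof.
move=> fh df; have -> : h = f + (fun y => h y - f y).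
  by apply/funext => y; rewrite fctE subrKC.
apply: differentiableD df _; apply: near0_differentiable.
by apply: filterS fh => y ->; rewrite subrr.
Qed.

Lemma open_near_eq U W (f h : 'rV[R]_n -> W) x : open U ->
  {in U, f =1 h} -> U x -> \near x, f x = h x.
Proof.
move=> oU fh Ux; apply: (@filterS _ (nbhs x) _ U) => [y Uy|].
  by apply: fh; rewrite inE.
exact: open_nbhs_nbhs.
Qed.

Lemma eq_Ck U W (f h : 'rV[R]_n -> W) k : open U ->
  {in U, f =1 h} -> Ck k U f -> Ck k U h.
Proof.
move=> oU; elim: k f h => [|k IH] f h fh /=.
  move=> fc x Ux; have nfh := open_near_eq oU fh Ux.
  rewrite /prop_for /continuous_at -(nbhs_singleton nfh).
 exact: cvg_trans (near_eq_cvg nfh) (fc x Ux).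
move=> [fd fD]; split=> [x Ux|i].
  exact: near_eq_differentiable (open_near_eq oU fh Ux) (fd x Ux).
apply: IH (fD i) => x; rewrite inE => Ux.
exact: near_eq_derive (open_near_eq oU fh Ux).
Qed.

(** Introduction rule for one more derivative: the partial derivatives need only
    be known on the open set U, where alone the usual rules compute them. *)
Lemma CkS_intro U W (f : 'rV[R]_n -> W) (d : 'I_n -> 'rV[R]_n -> W) k : open U ->
  (forall x, U x -> differentiable f x) ->
  (forall i x, U x -> 'D_(delta_mx 0 i) f x = d i x) ->
  (forall i, Ck k U (d i)) -> Ck k.+1 U f.
Proof.
move=> oU fd fD dC; split=> // i; apply: eq_Ck (dC i) => // x.
by rewrite inE => Ux; rewrite fD.
Qed.

Lemma CkS U W (f : 'rV[R]_n -> W) k : Ck k.+1 U f -> Ck k U f.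
Proof.
elim: k f => [|k IH] f /= [fd fD].
  by move=> x Ux; exact: differentiable_continuous (fd x Ux).
by split=> // i; apply: IH.
Qed.

Lemma Ck_local U W (f : 'rV[R]_n -> W) k :
  (forall x, U x -> exists2 V, V x & Ck k V f) -> Ck k U f.
Proof.
elim: k f => [|k IH] f loc /=.
  by move=> x Ux; have [V Vx /(_ x Vx)] := loc x Ux.
split=> [x Ux|i]; first by have [V Vx [/(_ x Vx)]] := loc x Ux.
by apply: IH => x Ux; have [V Vx [_ /(_ i)]] := loc x Ux; exists V.
Qed.

Lemma Ck_cst U W (a : W) k : Ck k U (fun=> a).
Proof.
elim: k a => [|k IH] a /=; first by move=> x _; exact: cst_continuous.
split=> [x _|i]; first exact: differentiable_cst.
rewrite (_ : 'D_ _ _ = fun=> 0) //; apply/funext => x; exact: derive_cst.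
Qed.

Lemma CkD U W (f h : 'rV[R]_n -> W) k : open U ->
  Ck k U f -> Ck k U h -> Ck k U (fun x => f x + h x).
Proof.
move=> oU; elim: k f h => [|k IH] f h.
  by move=> fc hc x Ux; exact: (continuousD (fc x Ux) (hc x Ux)).
move=> [fd fD] [hd hD].
apply: (@CkS_intro _ _ _
  (fun i x => 'D_(delta_mx 0 i) f x + 'D_(delta_mx 0 i) h x)) => //.
- by move=> x Ux; apply: differentiableD; [exact: fd|exact: hd].
- move=> i x Ux; apply: deriveD; apply: diff_derivable;
    [exact: fd|exact: hd].
- by move=> i; apply: IH; [exact: fD|exact: hD].
Qed.

Lemma CkM U (f h : 'rV[R]_n -> R) k : open U ->
  Ck k U f -> Ck k U h -> Ck k U (fun x => f x * h x).
Proof.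
move=> oU; elim: k f h => [|k IH] f h.
  by move=> fc hc x Ux; exact: (continuousM (fc x Ux) (hc x Ux)).
move=> fC hC; have [fd fD] := fC; have [hd hD] := hC.
apply: (@CkS_intro _ _ _ (fun i x => f x * 'D_(delta_mx 0 i) h x +
   h x * 'D_(delta_mx 0 i) f x)) => //.
- by move=> x Ux; apply: differentiableM; [exact: fd|exact: hd].
- by move=> i x Ux; apply: deriveM; apply: diff_derivable;
    [exact: fd|exact: hd].
- move=> i; apply: CkD => //.
    by apply: IH; [exact: CkS|exact: hD].
  by apply: IH; [exact: CkS|exact: fD].
Qed.

Lemma CkV U (f : 'rV[R]_n -> R) k : open U -> (forall x, U x -> f x != 0) ->
  Ck k U f -> Ck k U (fun x => (f x)^-1).
Proof.
move=> oU f0; elim: k => [|k IH].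
  by move=> fc x Ux; exact: (continuousV (f0 x Ux) (fc x Ux)).
move=> fC; have [fd fD] := fC; have IHf := IH (CkS fC).
apply: (@CkS_intro _ _ _
  (fun i x => - 1 * ((f x)^-1 * (f x)^-1) * 'D_(delta_mx 0 i) f x)) => //.
- by move=> x Ux; apply: differentiableV; [exact: fd|exact: f0].
- move=> i x Ux; rewrite deriveV ?f0 //; last exact: diff_derivable (fd x Ux).
  by rewrite mulN1r expr2 invfM.
- move=> i; apply: CkM => //; last exact: fD.
  by apply: CkM => //; [exact: Ck_cst|exact: CkM].
Qed.

Lemma Ck_sum U (I : Type) (r : seq I) (P : pred I) (f : I -> 'rV[R]_n -> R) k :
  open U -> (forall i, Ck k U (f i)) ->
  Ck k U (fun x => \sum_(i <- r | P i) f i x).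
Proof.
move=> oU fC; elim: r => [|i r IH].
  by under eq_fun do rewrite big_nil; exact: Ck_cst.
under eq_fun do rewrite big_cons.
by case: (P i) => //; exact: CkD.
Qed.

Lemma Ck_prod U (I : Type) (r : seq I) (P : pred I) (f : I -> 'rV[R]_n -> R) k :
  open U -> (forall i, Ck k U (f i)) ->
  Ck k U (fun x => \prod_(i <- r | P i) f i x).
Proof.
move=> oU fC; elim: r => [|i r IH].
  by under eq_fun do rewrite big_nil; exact: Ck_cst.
under eq_fun do rewrite big_cons.
by case: (P i) => //; exact: CkM.
Qed.

Lemma differentiable_mxP {p q : nat} (f : 'rV[R]_n -> 'M[R]_(p, q)) x :
  differentiable f x <-> forall i j, differentiable (fun y => f y i j) x.
Proof.
split=> [fd i j|fd].
  exact: (@differentiable_comp _ _ _ _ f (fun A => A i j : R) x fd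
    (differentiable_coord _ _ _)).
rewrite (_ : f = \sum_(i < p) \sum_(j < q) (fun y => f y i j *: delta_mx i j)).
  apply: differentiable_sum => i; apply: differentiable_sum => j.
  exact/differentiableZl/fd.
apply/funext => y; rewrite [LHS]matrix_sum_delta fct_sumE.
by apply: eq_bigr => i _; rewrite fct_sumE.
Qed.

Lemma Ck_mxP U {p q : nat} (f : 'rV[R]_n -> 'M[R]_(p, q)) k : open U ->
  Ck k U f <-> forall i j, Ck k U (fun x => f x i j).
Proof.
move=> oU; split=> [fC i j|].
- elim: k f fC => [|k IH] f.
    move=> fc x Ux; apply: (@continuous_comp _ _ _ f (fun A => A i j)).
      exact: fc.
    exact: coord_continuous.
  move=> [fd fD].
  apply: (@CkS_intro _ _ _ (fun l x => ('D_(delta_mx 0 l) f x) i j)) => //.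
  + by move=> x Ux; exact: (differentiable_mxP _ _).1 (fd x Ux) i j.
  + by move=> l x Ux; rewrite derive_mx ?mxE //; exact: diff_derivable (fd x Ux).
  + by move=> l; apply: IH; exact: fD.
- elim: k f => [|k IH] f fC.
    move=> x Ux; apply/(@cvgrPdist_le _ _ _ (nbhs x)) => /= e e0; near=> y.
    rewrite [leLHS]/Num.Def.normr /= mx_normrE (bigmax_le _ (ltW e0)) //= => i _.
    rewrite !mxE; move: i; near: y; apply: filter_forall => /= i.
    exact: ((cvgrPdist_le _ _).1 (fC i.1 i.2 x Ux)).
  apply: (@CkS_intro _ _ _
    (fun l x => \matrix_(i, j) 'D_(delta_mx 0 l) (fun y => f y i j) x)) => //.
  + by move=> x Ux; apply/differentiable_mxP => i j; exact: (fC i j).1.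
  + move=> l x Ux; apply: derive_mx; apply: diff_derivable.
    by apply/differentiable_mxP => i j; exact: (fC i j).1.
  + move=> l; apply: IH => i j; under eq_fun do rewrite mxE.
    exact: (fC i j).2.
Unshelve. all: by end_near. Qed.

Lemma Ck_mulmx U {p q r : nat} (f : 'rV[R]_n -> 'M[R]_(p, q))
    (h : 'rV[R]_n -> 'M[R]_(q, r)) k : open U ->
  Ck k U f -> Ck k U h -> Ck k U (fun x => f x *m h x).
Proof.
move=> oU /(Ck_mxP _ _ oU) fC /(Ck_mxP _ _ oU) hC; apply/(Ck_mxP _ _ oU) => i j.
under eq_fun do rewrite mxE.
by apply: Ck_sum => // l; exact: CkM.
Qed.

Lemma Ck_det U {p : nat} (f : 'rV[R]_n -> 'M[R]_p) k : open U ->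
  Ck k U f -> Ck k U (fun x => \det (f x)).
Proof.
move=> oU /(Ck_mxP _ _ oU) fC; apply: Ck_sum => // s.
by apply: CkM => //; [exact: Ck_cst|exact: Ck_prod].
Qed.

(** By Cramer's rule the entries of the inverse are polynomials in the entries
    divided by the determinant. *)
Lemma Ck_invmx U {p : nat} (f : 'rV[R]_n -> 'M[R]_p) k : open U ->
  (forall x, U x -> f x \in unitmx) ->
  Ck k U f -> Ck k U (fun x => invmx (f x)).
Proof.
move=> oU fu fC; have dC := Ck_det oU fC.
have := fC => /(Ck_mxP _ _ oU) fC'; apply/(Ck_mxP _ _ oU) => i j.
apply: (@eq_Ck _ _ (fun x => (\det (f x))^-1 * cofactor (f x) j i)) => // [x|].
  by rewrite inE => Ux; rewrite /invmx fu // !mxE.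
apply: CkM => //; first by apply: CkV => // x /fu; rewrite unitmxE unitfE.
apply: CkM => //; first exact: Ck_cst.
apply: Ck_det => //; apply/(Ck_mxP _ _ oU) => a b.
by under eq_fun do rewrite !mxE.
Qed.

End Calculus.

(** * A flat function on the line *)

Section FlatExp.
Context {R : realType}.

(** The powers of 1 / t make the family closed under derivation; [flat_exp 0] is
    the function of interest. *)
Definition flat_exp (m : nat) (t : R) : R :=
  if 0 < t then t^-1 ^+ m * expR (- t^-1) else 0.

(** The order 2 of vanishing at 0 is what makes the derivative at 0 vanish; it
    comes from exp u >= u^(m + 2) / (m + 2)! with u = 1 / t. *)
Lemma flat_exp_le m t : `|flat_exp m t| <= (m.+2)`!%:R * t ^+ 2.
Proof.
rewrite /flat_exp; case: ifP => [t0|_]; last first.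
  by rewrite normr0 mulr_ge0 // sqr_ge0.
have u0 : 0 < t^-1 by rewrite invr_gt0.
rewrite ger0_norm; last by rewrite mulr_ge0 ?expR_ge0 // exprn_ge0 // ltW.
have F0 : 0 < (m.+2)`!%:R :> R by rewrite ltr0n fact_gt0.
rewrite expRN ler_pdivrMr ?expR_gt0 //.
have -> : t^-1 ^+ m = (m.+2)`!%:R * t ^+ 2 * (t^-1 ^+ m.+2 / (m.+2)`!%:R).
  by rewrite !exprS; field; rewrite gt_eqF // gt_eqF.
apply: ler_wpM2l; first by rewrite mulr_ge0 ?sqr_ge0 ?(ltW F0).
by apply: le_trans (expR_ge1Dxn m.+1 (ltW u0)); rewrite lerDr.
Qed.

Lemma is_derive_flat_exp m (t : R) :
  is_derive t 1 (flat_exp m) (- m%:R * flat_exp m.+1 t + flat_exp m.+2 t).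
Proof.
have [t0|t0|->] := ltgtP t 0.
- have nt : \near t, 0 = flat_exp m t.
    near=> s; rewrite /flat_exp ifF //; apply/negbTE; rewrite -leNgt ltW //.
    by near: s; exact: lt_nbhsl.
  apply: (near_eq_is_derive nt).
  have -> : - m%:R * flat_exp m.+1 t + flat_exp m.+2 t = 0.
    by rewrite /flat_exp (lt_gtF t0) mulr0 addr0.
  exact: is_derive_cst.
- have nt : \near t, t^-1 ^+ m * expR (- t^-1) = flat_exp m t.
    near=> s; rewrite /flat_exp ifT //.
    by near: s; exact: lt_nbhsr.
  apply: (near_eq_is_derive nt).
  have dV : is_derive t 1 (fun s : R => s^-1) (- t ^- 2).
    apply: DeriveDef; first by apply: derivableV => //; rewrite gt_eqF.
    by rewrite deriveV ?gt_eqF // derive_id /GRing.scale /= mulr1.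
  have dE : is_derive t 1 (fun s : R => expR (- s^-1))
      (expR (- t^-1) * (t ^- 2)).
    have dN : is_derive t 1 (fun s : R => - s^-1) (t ^- 2).
      by rewrite -[t ^- 2]opprK; exact: is_deriveN.
    exact: (@is_derive1_comp _ expR (fun s : R => - s^-1)).
  have := is_deriveM (is_deriveX m dV) dE.
  rewrite (_ : (fun s : R => s^-1) ^+ m * _ =
     fun s => s^-1 ^+ m * expR (- s^-1)); last first.
    by apply/funext => s; rewrite fctE; congr (_ * _); rewrite fctE.
  move=> dm; apply: (is_derive_eq dm); rewrite /flat_exp t0 /GRing.scale /= fctE.
  rewrite -exprVn {dm nt}; case: m => [|m] /=; rewrite ?exprS.
    by rewrite !expr0; ring.
  ring.
- have f0 : flat_exp m 0 = 0 by rewrite /flat_exp ltxx.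
  have -> : - m%:R * flat_exp m.+1 0 + flat_exp m.+2 0 = 0.
    by rewrite /flat_exp !ltxx mulr0 addr0.
  suff c0 : h^-1 *: (flat_exp m (h *: 1 + 0) - flat_exp m 0) @[h --> 0^'] --> 0.
    by apply: DeriveDef; [apply/cvg_ex; exists 0|exact: cvg_lim c0].
  apply/cvgrPdist_le => /= e e0; near=> h.
  rewrite f0 subr0 addr0 sub0r normrN /GRing.scale /= mulr1 normrM normfV.
  have h0 : 0 < `|h| by rewrite normr_gt0; near: h; exact: nbhs_dnbhs_neq.
  rewrite mulrC ler_pdivrMr //; apply: le_trans (flat_exp_le _ _) _.
  rewrite -[h ^+ 2]ger0_norm ?sqr_ge0 // normrX expr2 mulrA ler_pM2r //.
  rewrite mulrC -ler_pdivlMr ?ltr0n ?fact_gt0 //.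
  near: h; apply: dnbhs0_le.
  by rewrite divr_gt0 ?ltr0n ?fact_gt0.
Unshelve. all: by end_near. Qed.

Lemma differentiable_flat_exp m t : differentiable (flat_exp m) t.
Proof. by apply/derivable1_diffP; have [] := is_derive_flat_exp m t. Qed.

Lemma derive_flat_exp_comp (V : normedModType R) (q : V -> R) m x v :
  differentiable q x -> 'D_v (flat_exp m \o q) x =
  (- m%:R * flat_exp m.+1 (q x) + flat_exp m.+2 (q x)) * 'D_v q x.
Proof.
move=> dq; have dF := differentiable_flat_exp m (q x).
rewrite deriveE; last exact: differentiable_comp.
rewrite diff_comp //= -(deriveE _ dq) diff1E // derive1E.
by rewrite (@derive_val _ _ _ _ _ _ _ (is_derive_flat_exp m (q x))) /GRing.scale /= mulrC.
Qed.

Lemma Ck_flat_exp n (U : set 'rV[R]_n) (q : 'rV[R]_n -> R) m k : open U ->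
  Ck k U q -> Ck k U (flat_exp m \o q).
Proof.
move=> oU; elim: k m => [|k IH] m.
  move=> qc x Ux; apply: continuous_comp; first exact: qc.
  exact/differentiable_continuous/differentiable_flat_exp.
move=> qC; have [qd qD] := qC.
apply: (@CkS_intro _ _ _ _ _ (fun i x => (- m%:R * flat_exp m.+1 (q x) +
   flat_exp m.+2 (q x)) * 'D_(delta_mx 0 i) q x)) => //.
- move=> x Ux; apply: differentiable_comp; first exact: qd.
  exact: differentiable_flat_exp.
- by move=> i x Ux; rewrite derive_flat_exp_comp //; exact: qd.
- move=> i; apply: CkM => //; last exact: qD.
  apply: CkD => //; last exact: IH (CkS qC).
  by apply: CkM => //; [exact: Ck_cst|exact: IH (CkS qC)].
Qed.

End FlatExp.

(** * Global 1-forms from bump functions *)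

Section Bump.
Context {R : realType} {n : nat}.
Implicit Types c x : 'rV[R]_n.

(** A smooth function supported in the ball of centre c and radius r. The
    Euclidean norm is smooth, and dominates the sup norm of row vectors, for
    which the support is controlled below. *)
Definition bump c (r : R) x : R :=
  flat_exp 0 (r ^+ 2 - \sum_k (x 0 k - c 0 k) ^+ 2).

Lemma bump_eq0 c r x : 0 <= r -> r < `|c - x| -> bump c r x = 0.
Proof.
move=> r0 rx; rewrite /bump /flat_exp ifF //; apply/negbTE.
rewrite -leNgt subr_le0 leNgt; apply/negP => sr.
have := rx; rewrite ltNge => /negP; apply.
rewrite [leLHS]/Num.Def.normr /= mx_normrE (bigmax_le _ r0) //= => -[i k] _.
rewrite !mxE ord1 /= distrC -(@ler_pXn2r _ 2) ?nnegrE ?normr_ge0 //.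
rewrite real_normK ?num_real // ltW //; apply: le_lt_trans sr.
by rewrite (bigD1 k) //= lerDl sumr_ge0 // => j _; exact: sqr_ge0.
Qed.

Lemma Ck_bump (U : set 'rV[R]_n) c r (h : 'rV[R]_n -> 'rV[R]_n) k : open U ->
  Ck k U h -> Ck k U (bump c r \o h).
Proof.
move=> oU /(Ck_mxP _ _ oU) hC.
have -> : (bump c r \o h) = flat_exp 0 \o
  (fun x => r ^+ 2 + - 1 * \sum_k (h x 0 k + - c 0 k) * (h x 0 k + - c 0 k)).
  by apply/funext => x; rewrite /bump /= mulN1r.
apply: Ck_flat_exp => //; apply: CkD; [by []|exact: Ck_cst|].
apply: CkM; [by []|exact: Ck_cst|].
by apply: Ck_sum => // l; apply: CkM => //; apply: CkD => //; exact: Ck_cst.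
Qed.

Lemma derive_coord x v (k : 'I_n) :
  is_derive x v (fun y : 'rV[R]_n => y 0 k : R) (v 0 k).
Proof.
apply: DeriveDef; first exact/diff_derivable/differentiable_coord.
have := @derive_mx _ _ 1 n id x v (@derivable_id _ _ x v).
by rewrite derive_id => /matrixP/(_ 0 k); rewrite mxE.
Qed.

Lemma derive_bump c (r : R) x v : 'D_v (bump c r) x =
  flat_exp 2 (r ^+ 2 - \sum_k (x 0 k - c 0 k) ^+ 2) *
  - (\sum_k 2 * (x 0 k - c 0 k) * v 0 k).
Proof.
pose h (k : 'I_n) : 'rV[R]_n -> R := (fun y => y 0 k) - cst (c 0 k).
pose q : 'rV[R]_n -> R := cst (r ^+ 2) - \sum_k h k ^+ 2.
have dq : is_derive x v q (- (\sum_k 2 * (x 0 k - c 0 k) * v 0 k)).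
  have dh k : is_derive x v (h k ^+ 2) (2 * (x 0 k - c 0 k) * v 0 k).
    have := is_deriveX 2 (is_deriveB (derive_coord x v k) (is_derive_cst (c 0 k) x v)).
    by move=> dX; apply: (is_derive_eq dX); rewrite subr0 /= expr1.
  have := is_deriveB (is_derive_cst (r ^+ 2) x v) (is_derive_sum dh).
  by rewrite sub0r.
have qE : q = fun y => r ^+ 2 - \sum_k (y 0 k - c 0 k) ^+ 2.
  apply/funext => y; rewrite /q fctE; congr (_ - _).
  by rewrite fct_sumE; apply: eq_bigr => k _; rewrite /h fctE.
have -> : bump c r = flat_exp 0 \o q by rewrite qE.
rewrite derive_flat_exp_comp; first by rewrite oppr0 mul0r add0r derive_val qE.
apply: differentiableB; first exact: differentiable_cst.
apply: differentiable_sum => k; apply: differentiableX.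
by apply: differentiableB; [exact: differentiable_coord|exact: differentiable_cst].
Qed.

End Bump.

Section Separation.
Context {R : realType} {n : nat} {M : smooth_manifold R n}.
Implicit Types (i j : chart M) (p q : M).

Lemma open_cod_preimage j (V : set M) : open V ->
  open (cod j `&` psi j @^-1` V).
Proof.
move=> oV; have cj := @cod_open _ _ M j.
apply: ((continuous_inP (psi j) cj).1 _ _ oV).
by rewrite -continuous_open_subspace //; exact: psi_continuous.
Qed.

Arguments open_cod_preimage j [V].

Definition extend0 i (F : 'rV[R]_n -> R) (q : M) : R :=
  if `[< dom i q >] then F (phi i q) else 0.

(** The closed ball is compact, hence so is its image in the manifold, which is
    therefore closed, the space being Hausdorff. Its complement and the domain
    of the chart are two open sets which cover the manifold; the extension is
    0 on the first one, and a bump function composed with a transition map on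
    the second. *)
Lemma smooth_fun_extend0_bump i (c : 'rV[R]_n) (r : R) : 0 <= r ->
  (forall y, `|c - y| <= r -> cod i y) ->
  smooth_fun (extend0 i (bump c r)).
Proof.
move=> r0 ballcod j k.
pose B := [set y | `|c - y| <= r].
have KB : compact (psi i @` B).
  apply: continuous_compact.
    apply: (continuous_subspaceW _ (@psi_continuous _ _ M i)) => y; exact: ballcod.
  apply: bounded_closed_compact; last exact: closed_closed_ball_.
  exists (`|c| + r); split; first exact: num_real.
  move=> s rs y /= yr; apply: le_trans (ltW rs).
  by rewrite -[y](subKr c) (le_trans (ler_normB _ _)) // lerD2l.
have oK : open (~` (psi i @` B)).
  apply: closed_openC; apply: compact_closed => //; exact: manifold_hausdorff.
apply: Ck_local => x xj; have [xi|xi] := pselect (dom i (psi j x)).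
  exists (cod j `&` psi j @^-1` dom i) => //.
  have oV := open_cod_preimage j (@dom_open _ _ M i).
  apply: (@eq_Ck _ _ _ _ (bump c r \o (phi i \o psi j))) => //.
    move=> y; rewrite inE => -[_ yi]; rewrite /extend0 /= asboolT //.
  by apply: Ck_bump => //; exact: transition_smooth.
exists (cod j `&` psi j @^-1` (~` (psi i @` B))).
  by split => // -[y /ballcod yi] yx; apply: xi; rewrite -yx; exact: psi_dom.
apply: (@eq_Ck _ _ _ _ (fun=> 0)); [exact: open_cod_preimage| |exact: Ck_cst].
move=> y; rewrite inE => -[_ yK]; rewrite /extend0 /=.
case: asboolP => // yi; rewrite bump_eq0 // ltNge; apply/negP => yB.
by apply: yK; exists (phi i (psi j y)) => //; exact: phiK.
Qed.

Definition differential (f : M -> R) : section M := fun i p =>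
  if `[< dom i p >] then \row_k 'D_(delta_mx 0 k) (f \o psi i) (phi i p) else 0.

(** The transformation law of a 1-form is the chain rule for the transition map. *)
Lemma one_form_differential f : smooth_fun f -> one_form (differential f).
Proof.
move=> fS; split=> [i k|i j p pi pj|i p pi]; last first.
- by rewrite /differential asboolF.
- have fi := fS i 1%N; have fj := fS j 1%N.
  rewrite /differential !asboolT //; apply/rowP => k; rewrite !mxE.
  have oV := open_cod_preimage i (@dom_open _ _ M j).
  have pV : (cod i `&` psi i @^-1` dom j) (phi i p).
    by split; [exact: phi_cod|rewrite /= phiK].
  have dT : differentiable (phi j \o psi i) (phi i p).
    by have [+ _] := @transition_smooth _ _ M i j 1%N; apply.
  have jp : (phi j \o psi i) (phi i p) = phi j p by rewrite /= phiK.
  have dj : differentiable (f \o psi j) (phi j p).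
    by apply: fj.1; exact: phi_cod.
  have -> : 'D_(delta_mx 0 k) (f \o psi i) (phi i p) =
            'D_(delta_mx 0 k) ((f \o psi j) \o (phi j \o psi i)) (phi i p).
    apply: near_eq_derive; apply: (open_near_eq oV) pV => y; rewrite inE => -[_ yj].
    by rewrite /= phiK.
  rewrite deriveE; last by apply: differentiable_comp; rewrite ?jp.
  rewrite diff_comp ?jp //= -(deriveE _ dT) deriveEjacobian // -rowE.
  rewrite [X in 'd _ _ X]row_sum_delta linear_sum; apply: eq_bigr => l _.
  by rewrite linearZ /= -deriveE // !mxE mulrC.
- have cj := @cod_open _ _ M i.
  apply: (@eq_Ck _ _ _ _ (fun x => \row_l 'D_(delta_mx 0 l) (f \o psi i) x)) => //.
    move=> x; rewrite inE => xi.
    by rewrite /differential /= asboolT ?psiK //; exact: psi_dom.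
  apply/Ck_mxP => // a l; under eq_fun do rewrite mxE.
  exact: (fS i k.+1).2.
Qed.

(** The differential of a bump function whose centre is shifted from the point by
    e / 4 in the direction l: the ball of radius e / 2 around the centre contains
    the point and remains in the ball of radius e around it. *)
Lemma one_form_delta i p (l : 'I_n) : dom i p ->
  exists2 a, one_form a & exists2 s, s != 0 & a i p = s *: delta_mx 0 l.
Proof.
move=> pi; have : open_nbhs (phi i p) (cod i).
  by split; [exact: cod_open|exact: phi_cod].
move=> /open_nbhs_nbhs /nbhs_ballP [e /= e0]; rewrite -ball_normE => eB.
set x := phi i p in eB *.
pose c := x + (e / 4) *: delta_mx 0 l.
have nd : `|delta_mx 0 l : 'rV[R]_n| <= 1.
  rewrite [leLHS]/Num.Def.normr /= mx_normrE bigmax_le // => k _.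
  by rewrite mxE; case: (_ && _); rewrite ?normr1 ?normr0.
have xc k : x 0 k - c 0 k = - (e / 4) * (k == l)%:R.
  by rewrite !mxE eqxx /= opprD addNKr mulNr.
exists (differential (extend0 i (bump c (e / 2)))).
  apply: one_form_differential; apply: smooth_fun_extend0_bump.
    by rewrite divr_ge0 // ltW.
  move=> y yc; apply: eB; rewrite /= -(subrKA c).
  rewrite (le_lt_trans (ler_normD _ _)) //.
  have : `|x - c| <= e / 4.
    rewrite /c opprD addNKr normrN normrZ gtr0_norm ?divr_gt0 //.
    by rewrite ler_piMr // ltW // divr_gt0.
  lra.
exists (flat_exp 2 ((e / 2) ^+ 2 - (e / 4) ^+ 2) * (e / 2)).
  rewrite mulf_neq0 ?gt_eqF ?divr_gt0 // /flat_exp ifT; last by nra.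
  by rewrite mulr_gt0 ?expR_gt0 // exprn_gt0 // invr_gt0; nra.
rewrite /differential asboolT //; apply/rowP => k; rewrite !mxE -/x.
have -> : 'D_(delta_mx 0 k) (extend0 i (bump c (e / 2)) \o psi i) x =
          'D_(delta_mx 0 k) (bump c (e / 2)) x.
  apply: near_eq_derive; apply: (open_near_eq (@cod_open _ _ M i)).
    move=> y; rewrite inE => yi.
    by rewrite /extend0 /= asboolT ?psiK //; exact: psi_dom.
  exact: phi_cod.
rewrite derive_bump; under eq_bigr do rewrite xc.
rewrite (bigD1 l) //= big1 ?addr0 => [|m /negPf ->]; last by rewrite mulr0 expr0n.
rewrite eqxx mulr1 sqrrN -mulrA; congr (_ * _).
under eq_bigr do rewrite xc !mxE eqxx /=.
rewrite (bigD1 l) //= big1 ?addr0 => [|m /negPf ->]; last by rewrite !(mulr0, mul0r).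
by rewrite eqxx eq_sym mulr1n; field.
Qed.

End Separation.

(** * Algebra of sections and metrics *)

Section Sections.
Context {R : realType} {n : nat} {M : smooth_manifold R n}.
Implicit Types (i j : chart M) (p : M) (X Y Z : section M) (a b u v : section M).
Implicit Types (g h : section2 M) (l : R).

Lemma sectionDE u v i p : (u + v) i p = u i p + v i p. Proof. by []. Qed.
Lemma sectionBE u v i p : (u - v) i p = u i p - v i p. Proof. by []. Qed.
Lemma sectionZE l u i p : (l *: u) i p = l *: u i p. Proof. by []. Qed.
Definition sectionE := (sectionDE, sectionBE, sectionZE).

Lemma eq_section u v : (forall i p, u i p = v i p) -> u = v.
Proof. by move=> uv; apply/funext => i; apply/funext => p. Qed.

Lemma smoothD m (U : set 'rV[R]_n) (f k : 'rV[R]_n -> 'M[R]_(m, n)) : open U ->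
  smooth U f -> smooth U k -> smooth U (fun x => f x + k x).
Proof. by move=> oU fS kS r; exact: CkD. Qed.

Lemma smoothZ m (U : set 'rV[R]_n) (f : 'rV[R]_n -> 'M[R]_(m, n)) l : open U ->
  smooth U f -> smooth U (fun x => l *: f x).
Proof.
move=> oU fS r; apply/Ck_mxP => // i j; under eq_fun do rewrite mxE.
apply: CkM => //; first exact: Ck_cst.
by have /(Ck_mxP _ _ oU) := fS r.
Qed.

Lemma vector_fieldD X Y :
  vector_field X -> vector_field Y -> vector_field (X + Y).
Proof.
move=> [Xs Xj X0] [Ys Yj Y0]; split=> [i|i j p pi pj|i p pi].
- by apply: smoothD; [exact: cod_open|exact: Xs|exact: Ys].
- by rewrite !sectionE mulmxDl (Xj i j) // (Yj i j).
- by rewrite sectionE X0 // Y0 // addr0.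
Qed.

Lemma vector_fieldZ l X : vector_field X -> vector_field (l *: X).
Proof.
move=> [Xs Xj X0]; split=> [i|i j p pi pj|i p pi].
- by apply: smoothZ; [exact: cod_open|exact: Xs].
- by rewrite !sectionE -scalemxAl (Xj i j).
- by rewrite sectionE X0 // scaler0.
Qed.

Lemma vector_fieldB X Y :
  vector_field X -> vector_field Y -> vector_field (X - Y).
Proof.
by move=> VX VY; rewrite -scaleN1r; apply/vector_fieldD/vector_fieldZ.
Qed.

Lemma one_formD a b : one_form a -> one_form b -> one_form (a + b).
Proof.
move=> [As Aj A0] [Bs Bj B0]; split=> [i|i j p pi pj|i p pi].
- by apply: smoothD; [exact: cod_open|exact: As|exact: Bs].
- by rewrite !sectionE mulmxDl (Aj i j) // (Bj i j).
- by rewrite sectionE A0 // B0 // addr0.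
Qed.

Lemma one_formZ l a : one_form a -> one_form (l *: a).
Proof.
move=> [As Aj A0]; split=> [i|i j p pi pj|i p pi].
- by apply: smoothZ; [exact: cod_open|exact: As].
- by rewrite !sectionE -scalemxAl (Aj i j).
- by rewrite sectionE A0 // scaler0.
Qed.

Lemma one_formB a b : one_form a -> one_form b -> one_form (a - b).
Proof.
by move=> Fa Fb; rewrite -scaleN1r; apply/one_formD/one_formZ.
Qed.

(** A 1-form and a vector field have the same type of components, so that the
    pairing can be read in both orders. *)
Lemma contractC u v : contract u v = contract v u.
Proof.
apply/funext => p; rewrite /contract.
have -> : v (chart_at p) p *m (u (chart_at p) p)^T =
    (u (chart_at p) p *m (v (chart_at p) p)^T)^T by rewrite trmx_mul trmxK.
by rewrite [RHS]mxE.
Qed.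

Lemma contractDr u v w : contract u (v + w) = contract u v + contract u w.
Proof.
by apply/funext => p; rewrite /contract !sectionE linearD mulmxDr mxE.
Qed.

Lemma contractZr l u v : contract u (l *: v) = l *: contract u v.
Proof.
by apply/funext => p; rewrite /contract !sectionE linearZ -scalemxAr mxE.
Qed.

Lemma contractZl l u v : contract (l *: u) v = l *: contract u v.
Proof. by rewrite contractC contractZr contractC. Qed.

Lemma contractBr u v w : contract u (v - w) = contract u v - contract u w.
Proof. by rewrite -scaleN1r contractDr contractZr scaleN1r. Qed.

Lemma contractBl u v w : contract (u - v) w = contract u w - contract v w.
Proof. by rewrite !(contractC _ w) contractBr. Qed.

Lemma sharpD h u v : sharp h (u + v) = sharp h u + sharp h v.
Proof. by apply: eq_section => i p; rewrite /sharp !sectionE mulmxDl. Qed.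

Lemma sharpZ h l u : sharp h (l *: u) = l *: sharp h u.
Proof. by apply: eq_section => i p; rewrite /sharp !sectionE scalemxAl. Qed.

Lemma sharpB h u v : sharp h (u - v) = sharp h u - sharp h v.
Proof. by rewrite -scaleN1r sharpD sharpZ scaleN1r. Qed.

Lemma form2E h u v : form2 h u v = contract (sharp h u) v.
Proof. by []. Qed.

Definition symmetric h := forall i p, dom i p -> (h i p)^T = h i p.

Lemma contract_sharp h u v : symmetric h ->
  contract (sharp h u) v = contract u (sharp h v).
Proof.
move=> hs; apply/funext => p; rewrite /contract /sharp trmx_mul hs ?mulmxA //.
exact: dom_chart_at.
Qed.

Lemma metric_sym g : metric g -> symmetric g. Proof. by case. Qed.

Lemma dual_sym g : symmetric g -> symmetric (dual g).
Proof. by move=> gs i p pi; rewrite /dual trmx_inv gs. Qed.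

(** The determinant of g i p is that of g j p times the square of that of the
    Jacobian, and does not vanish. This avoids differentiating the inverse
    transition map. *)
Lemma metric_jac g i j p : metric g -> dom i p -> dom j p -> jac i j p \in unitmx.
Proof.
move=> [_ gj _ gu] pi pj; have := gu i p pi.
by rewrite (gj i j p) // !unitmx_mul => /andP[/andP[]].
Qed.

(** The formula of [sharp] lowers indices when it is given the metric itself. *)
Lemma one_form_flat g X : metric g -> vector_field X -> one_form (sharp g X).
Proof.
move=> [gs gj _ _] [Xs Xj X0]; split=> [i k|i j p pi pj|i p pi].
- by apply: Ck_mulmx; [exact: cod_open|exact: Xs|exact: gs].
- by rewrite /sharp (gj i j p) // (Xj i j p) // !mulmxA.
- by rewrite /sharp X0 // mul0mx.
Qed.

Lemma dual_jac g i j p : metric g -> dom i p -> dom j p ->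
  dual g j p = (jac i j p)^T *m dual g i p *m jac i j p.
Proof.
move=> mg pi pj; have Ju := metric_jac mg pi pj; have [_ gj _ gu] := mg.
have giu := gu i p pi; have gju := gu j p pj; have e := gj i j p pi pj.
rewrite -unitmx_tr in Ju.
have JB : jac i j p *m g j p = g i p *m invmx (jac i j p)^T.
  exact: canRL (mulmxK Ju) (esym e).
apply: (can_inj (mulmxK gju)); rewrite mulVmx // -!mulmxA JB.
by rewrite mulKmx // mulmxV.
Qed.

Lemma dual_smooth g i : metric g -> smooth (cod i) (dual g i \o psi i).
Proof.
move=> [gs _ _ gu] k; apply: Ck_invmx; [exact: cod_open| |exact: gs].
by move=> x xi; apply: gu; exact: psi_dom.
Qed.

Lemma vector_field_sharp g a :
  metric g -> one_form a -> vector_field (sharp (dual g) a).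
Proof.
move=> mg [As Aj A0]; split=> [i k|i j p pi pj|i p pi].
- by apply: Ck_mulmx; [exact: cod_open|exact: As|exact: dual_smooth].
- by rewrite /sharp (dual_jac mg pi pj) (Aj i j p) // !mulmxA.
- by rewrite /sharp A0 // mul0mx.
Qed.

Lemma flat_sharp g a : metric g -> one_form a -> sharp g (sharp (dual g) a) = a.
Proof.
move=> [_ _ _ gu] [_ _ A0]; apply: eq_section => i p; rewrite /sharp /dual.
have [pi|pi] := pselect (dom i p); first by rewrite mulmxKV //; exact: gu.
by rewrite A0 // !mul0mx.
Qed.

Lemma sharp_flat g X :
  metric g -> vector_field X -> sharp (dual g) (sharp g X) = X.
Proof.
move=> [_ _ _ gu] [_ _ X0]; apply: eq_section => i p; rewrite /sharp /dual.
have [pi|pi] := pselect (dom i p); first by rewrite mulmxK //; exact: gu.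
by rewrite X0 // !mul0mx.
Qed.

Lemma metric_dual_pencil g g' l : metric g -> metric g' ->
  nondegenerate (pencil g g' l) -> metric (dual (pencil g g' l)).
Proof.
move=> mg mg' pu; split=> [i k|i j p pi pj|i p pi|i p pi].
- apply: Ck_invmx => [||]; first exact: cod_open.
    by move=> x xi; apply: pu; exact: psi_dom.
  apply: smoothD; [exact: cod_open|exact: dual_smooth|].
  by apply: smoothZ; [exact: cod_open|exact: dual_smooth].
- have e : pencil g g' l j p = (jac i j p)^T *m pencil g g' l i p *m jac i j p.
    rewrite /pencil !fctE /= (dual_jac mg pi pj) (dual_jac mg' pi pj).
    by rewrite mulmxDr mulmxDl -scalemxAr -scalemxAl.
  have Ju := metric_jac mg pi pj; have pju := pu j p pj; have piu := pu i p pi.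
  apply: (can_inj (mulmxK piu)); rewrite mulVmx //.
  apply: (can_inj (mulmxK Ju)); rewrite mul1mx -!mulmxA.
  by rewrite (mulmxA _^T) -e mulVmx // mulmx1.
- by rewrite dual_sym // => {}i {}p {}pi; rewrite linearD linearZ /= !dual_sym //;
    exact: metric_sym.
- by rewrite unitmx_inv; exact: pu.
Qed.

Lemma dualK h : dual (dual h) = h.
Proof. by apply/funext => i; apply/funext => p; rewrite /dual invmxK. Qed.

(** Global 1-forms separate vector fields, because at each point they take, up to
    a nonzero factor, all the values of the standard basis. *)
Lemma vector_field_eq X Y : vector_field X -> vector_field Y ->
  (forall a, one_form a -> contract a X = contract a Y) -> X = Y.
Proof.
move=> VX VY XY; apply/eqP; rewrite -subr_eq0; apply/eqP.
have [_ Zj Z0] := vector_fieldB VX VY.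
have Zp p : (X - Y) (chart_at p) p = 0.
  apply/rowP => l; rewrite [RHS]mxE.
  have [a Fa [s s0 ae]] := one_form_delta l (dom_chart_at p).
  have : contract a (X - Y) p = 0 by rewrite contractBr XY // subrr.
  rewrite /contract ae -scalemxAl mxE -rowE mxE mxE => /eqP.
  by rewrite mulf_eq0 (negPf s0) /= => /eqP.
apply: eq_section => i p; have [pi|pi] := pselect (dom i p); last exact: Z0.
by rewrite (Zj (chart_at p) i) ?Zp ?mul0mx //; exact: dom_chart_at.
Qed.

(** The metric turns the separation of vector fields into that of 1-forms. *)
Lemma one_form_eq g a b : metric g -> one_form a -> one_form b ->
  (forall X, vector_field X -> contract a X = contract b X) -> a = b.
Proof.
move=> mg Fa Fb ab; rewrite -(flat_sharp mg Fa) -(flat_sharp mg Fb).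
congr sharp; apply: vector_field_eq; try exact: vector_field_sharp.
move=> c Fc; rewrite !(contractC c) !contract_sharp; try exact/dual_sym/metric_sym.
by apply: ab; exact: vector_field_sharp.
Qed.

End Sections.

Section Connections.
Context {R : realType} {n : nat} {M : smooth_manifold R n}.
Implicit Types (X Y Z : section M) (a b : section M).
Variables (g : section2 M) (D : section M -> section M -> section M).
Hypotheses (mg : metric g) (lcD : levi_civita g D).

(** The induced derivative of a is the 1-form dual to D X of the vector field dual
    to a: as g is parallel, it has the required values. *)
Lemma induced_spec X a : vector_field X -> one_form a ->
  one_form (induced D X a) /\ forall Y, vector_field Y ->
    contract (induced D X a) Y = act X (contract a Y) - contract a (D X Y).
Proof.
move=> VX Fa; have [[DV _ _ _] _ Dg] := lcD.
have Va := vector_field_sharp mg Fa.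
rewrite /induced; apply: (@xgetPex _ 0 [set b | _ b /\ _]).
exists (sharp g (D X (sharp (dual g) a))); split.
  by apply: one_form_flat => //; exact: DV.
move=> Y VY; rewrite -form2E -[in RHS](flat_sharp mg Fa) -!form2E Dg //.
by rewrite addrK.
Qed.

Lemma one_form_induced X a : vector_field X -> one_form a ->
  one_form (induced D X a).
Proof. by move=> VX Fa; have [] := induced_spec VX Fa. Qed.

(** The isomorphism between T*M and TM given by g is parallel. *)
Lemma sharp_induced X a : vector_field X -> one_form a ->
  sharp (dual g) (induced D X a) = D X (sharp (dual g) a).
Proof.
move=> VX Fa; have [Fi ie] := induced_spec VX Fa; have [[DV _ _ _] _ Dg] := lcD.
have Va := vector_field_sharp mg Fa; have VD := DV _ _ VX Va.
rewrite -[RHS](sharp_flat mg VD); congr sharp.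
apply: (one_form_eq mg Fi); first exact: one_form_flat.
move=> Y VY; rewrite ie // -[in LHS](flat_sharp mg Fa) -!form2E Dg //.
by rewrite addrK.
Qed.

Lemma connectionD X Y Z : vector_field X -> vector_field Y -> vector_field Z ->
  D X (Y + Z) = D X Y + D X Z.
Proof. by move=> VX VY VZ; have [[_ + _ _] _ _] := lcD; case/(_ X Y Z VX VY VZ). Qed.

(** Leibniz rule for a constant function, whose derivative is 0. *)
Lemma connectionZ X Y (l : R) : vector_field X -> vector_field Y ->
  D X (l *: Y) = l *: D X Y.
Proof.
move=> VX VY; have [[_ _ _ +] _ _] := lcD.
have ls : smooth_fun (fun _ : M => l) by move=> i k; exact: Ck_cst.
move=> /(_ _ _ _ ls VX VY); rewrite (_ : scale (act _ _) Y = 0) ?add0r //.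
apply: eq_section => i p; rewrite /scale /act.
by rewrite (_ : _ \o _ = cst l) // derive_cst scale0r.
Qed.

Lemma connectionB X Y Z : vector_field X -> vector_field Y -> vector_field Z ->
  D X (Y - Z) = D X Y - D X Z.
Proof.
move=> VX VY VZ; rewrite -scaleN1r connectionD //; last exact: vector_fieldZ.
by rewrite connectionZ // scaleN1r.
Qed.

(** The right-hand side does not depend on the connection, which is the form in
    which torsion-freeness is used. *)
Lemma induced_torsion X Y a : vector_field X -> vector_field Y -> one_form a ->
  contract (induced D X a) Y - contract (induced D Y a) X =
  act X (contract a Y) - act Y (contract a X) - contract a (lie_bracket X Y).
Proof.
move=> VX VY Fa; have [_ -> //] := induced_spec VX Fa.
have [_ -> //] := induced_spec VY Fa; have [_ tD _] := lcD.
rewrite -tD // contractBr !opprB addrACA [RHS]addrACA; congr (_ + _).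
exact: addrC.
Qed.

End Connections.

(** * Almost compatible metrics *)

(** The right-hand side of [induced_torsion] is common to the two connections. *)
Lemma induced_sub_sym (R : realType) (n : nat) (M : smooth_manifold R n)
    (g1 g2 : section2 M) (D1 D2 : section M -> section M -> section M)
    (X Y a : section M) :
  metric g1 -> metric g2 -> levi_civita g1 D1 -> levi_civita g2 D2 ->
  vector_field X -> vector_field Y -> one_form a ->
  contract (induced D1 X a - induced D2 X a) Y =
  contract (induced D1 Y a - induced D2 Y a) X.
Proof.
move=> m1 m2 lc1 lc2 VX VY Fa; apply/eqP; rewrite -subr_eq0 !contractBl.
rewrite opprB addrACA [- _ + _]addrC addrA.
have := induced_torsion m1 lc1 VX VY Fa; rewrite -(induced_torsion m2 lc2 VX VY Fa).
move=> /eqP; rewrite -subr_eq0 opprB => /eqP <-.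
apply/eqP; rewrite -!addrA; congr (_ + _).
by rewrite addrC -!addrA; congr (_ + _); rewrite addrC.
Qed.

Lemma sharp_curvature (R : realType) (n : nat) (M : smooth_manifold R n)
    (h : section2 M) (D : section M -> section M -> section M)
    (X Y a : section M) :
  sharp h (curvature D X Y a) = sharp h (induced D X (induced D Y a)) -
    sharp h (induced D Y (induced D X a)) - sharp h (induced D (lie_bracket X Y) a).
Proof. by rewrite /curvature (sharpB _ (_ - _)) sharpB. Qed.

Section AlmostCompatible.
Context {R : realType} {n : nat} {M : smooth_manifold R n}.
Variables (g g' : section2 M).
Variables (D D' : section M -> section M -> section M).
Variables (Dl : R -> section M -> section M -> section M).
Hypotheses (mg : metric g) (mg' : metric g').
Hypothesis pencil_nd : forall l, nondegenerate (pencil g g' l).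
Hypotheses (lcD : levi_civita g D) (lcD' : levi_civita g' D').
Hypothesis lcDl : forall l, levi_civita (dual (pencil g g' l)) (Dl l).
Hypothesis ac : almost_compatible g g' D D' Dl.
Implicit Types (X Y Z : section M) (a b u v : section M) (l : R).

Local Notation A := (sharp (dual g)).
Local Notation B := (sharp (dual g')).
Local Notation C l := (sharp (pencil g g' l)).
Local Notation F l := (sharp (dual (pencil g g' l))).
Local Notation N := (induced D).
Local Notation N' := (induced D').
Local Notation K X a := (induced D' X a - induced D X a).

Let mF l : metric (dual (pencil g g' l)).
Proof. exact: metric_dual_pencil. Qed.

Let symA : symmetric (dual g). Proof. exact/dual_sym/metric_sym. Qed.
Let symB : symmetric (dual g'). Proof. exact/dual_sym/metric_sym. Qed.
Let symF l : symmetric (dual (pencil g g' l)). Proof. exact: metric_sym. Qed.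

Let VA a : one_form a -> vector_field (A a).
Proof. exact: vector_field_sharp. Qed.
Let VB a : one_form a -> vector_field (B a).
Proof. exact: vector_field_sharp. Qed.
Let FF l X : vector_field X -> one_form (F l X).
Proof. exact: one_form_flat. Qed.
Let FN X a : vector_field X -> one_form a -> one_form (N X a).
Proof. exact: (one_form_induced mg lcD). Qed.
Let FN' X a : vector_field X -> one_form a -> one_form (N' X a).
Proof. exact: (one_form_induced mg' lcD'). Qed.
Let FNl l X a : vector_field X -> one_form a -> one_form (induced (Dl l) X a).
Proof. exact: (one_form_induced (mF l) (lcDl l)). Qed.
Let FK X a : vector_field X -> one_form a -> one_form (K X a).
Proof. by move=> VX Fa; apply: one_formB; [exact: FN'|exact: FN]. Qed.

Lemma sharp_pencil l u : C l u = A u + l *: B u.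
Proof.
apply: eq_section => i p; rewrite !sectionE /sharp /pencil.
by rewrite scalemxAr -mulmxDr.
Qed.

Lemma pencil_flat l X : vector_field X -> C l (F l X) = X.
Proof.
by move=> VX; have := sharp_flat (mF l) VX; rewrite dualK.
Qed.

Lemma flat_pencil l a : one_form a -> F l (C l a) = a.
Proof.
by move=> Fa; have := flat_sharp (mF l) Fa; rewrite dualK.
Qed.

(** Both sides are A a - A F A a, because A F C and C F A are both A. *)
Lemma sharp_flat_sharpC l a : one_form a ->
  A (F l (l *: B a)) = l *: B (F l (A a)).
Proof.
move=> Fa; have VAa := VA Fa.
have e1 : A (F l (C l a)) = A a by rewrite flat_pencil.
have e2 : C l (F l (A a)) = A a by rewrite pencil_flat.
move: e1; rewrite -[RHS]e2 [C l (F _ _)]sharp_pencil [C l a]sharp_pencil !sharpD.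
exact: addrI.
Qed.

(** Almost compatibility reads C N^l = A N + l B N', that is C (N^l - N) = l B K. *)
Lemma induced_pencil_g l X a : vector_field X -> one_form a ->
  induced (Dl l) X a - N X a = F l (l *: B (K X a)).
Proof.
move=> VX Fa; have FNa := FN VX Fa.
rewrite -(@flat_pencil l (_ - _)); last exact/one_formB/FNa/FNl.
congr sharp; rewrite [LHS]sharpB ac // sharp_pencil sharpB scalerBr opprD addrACA subrr.
exact: add0r.
Qed.

Lemma induced_pencil_g' l X a : vector_field X -> one_form a ->
  N' X a - induced (Dl l) X a = F l (A (K X a)).
Proof.
move=> VX Fa; have FNa := FN' VX Fa.
rewrite -(@flat_pencil l (_ - _)); last exact/one_formB/FNl.
congr sharp; rewrite [LHS]sharpB ac // sharp_pencil sharpB opprD addrACA subrr.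
exact: addr0.
Qed.

Lemma difference_sym X Y a : vector_field X -> vector_field Y -> one_form a ->
  contract (K X a) Y = contract (K Y a) X.
Proof. exact: (induced_sub_sym mg' mg lcD' lcD). Qed.

(** By the symmetry of K and self-adjointness, the pairing of the right-hand side
    with Y is that of F l B K_Y a with X; this 1-form is (N^l - N)_Y a, so the
    symmetry for the connection of the pencil exchanges X and Y. *)
Lemma difference_pencil_g' l X a : vector_field X -> one_form a ->
  F l (l *: B (K X a)) = K (l *: B (F l X)) a.
Proof.
move=> VX Fa; have FKa := FK VX Fa.
have VW : vector_field (l *: B (F l X)) by apply/vector_fieldZ/VB/FF.
apply: (one_form_eq mg); [exact/FF/vector_fieldZ/VB|exact: FK|].
move=> Y VY; rewrite (difference_sym VW) //.
have <- : contract (F l (l *: B (K Y a))) X = contract (K Y a) (l *: B (F l X)).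
  by rewrite contract_sharp // contractZl contract_sharp // contractZr.
rewrite -(induced_pencil_g l VX Fa) -(induced_pencil_g l VY Fa).
exact: (induced_sub_sym (mF l) mg (lcDl l) lcD).
Qed.

(** The same argument with N' - N^l in place of N^l - N. *)
Lemma difference_pencil_g l X a : vector_field X -> one_form a ->
  F l (A (K X a)) = K (A (F l X)) a.
Proof.
move=> VX Fa; have FKa := FK VX Fa.
have VW : vector_field (A (F l X)) by apply/VA/FF.
apply: (one_form_eq mg); [exact/FF/VA|exact: FK|].
move=> Y VY; rewrite (difference_sym VW) //.
have <- : contract (F l (A (K Y a))) X = contract (K Y a) (A (F l X)).
  by rewrite !contract_sharp.
rewrite -(induced_pencil_g' l VX Fa) -(induced_pencil_g' l VY Fa).
exact: (induced_sub_sym mg' (mF l) lcD' (lcDl l)).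
Qed.

(** The difference of the connections on 1-forms is minus the transpose of the
    difference of the connections on vector fields. *)
Lemma contract_difference X Y a : vector_field X -> vector_field Y -> one_form a ->
  contract (K X a) Y = contract a (D X Y - D' X Y).
Proof.
move=> VX VY Fa; rewrite contractBl contractBr.
have [_ -> //] := induced_spec mg lcD VX Fa.
have [_ -> //] := induced_spec mg' lcD' VX Fa.
by rewrite opprB addrC addrA subrK.
Qed.

(** In C N^l_X N^l_Y a = A N_X (N^l_Y a) + l B N'_X (N^l_Y a), N^l_Y a is written
    as N_Y a + F l B K_Y a in the first term and as N'_Y a - F A K_Y a in the
    second one. The two corrections involve the same vector field
    Z = A F l B K_Y a = l B F A K_Y a, derived with D and with D'. *)
Lemma curvature_defect l X Y a :
  vector_field X -> vector_field Y -> one_form a ->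
  C l (curvature (Dl l) X Y a) -
    (A (curvature D X Y a) + l *: B (curvature D' X Y a)) =
  (let Z := A (F l (l *: B (K Y a))) in D X Z - D' X Z) -
  (let Z := A (F l (l *: B (K X a))) in D Y Z - D' Y Z).
Proof.
have step U V : vector_field U -> vector_field V -> one_form a ->
    C l (induced (Dl l) U (induced (Dl l) V a)) =
    A (N U (N V a)) + l *: B (N' U (N' V a)) +
    (let Z := A (F l (l *: B (K V a))) in D U Z - D' U Z).
  move=> VU VV Fa /=; have FKa := FK VV Fa.
  have Fl : one_form (F l (l *: B (K V a))) by apply/FF/vector_fieldZ/VB.
  have Fl' : one_form (F l (A (K V a))) by apply/FF/VA.
  have VBF := VB Fl'.
  have Fn := FNl l VV Fa; have Fg := FN VV Fa; have Fg' := FN' VV Fa.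
  transitivity (A (N U (induced (Dl l) V a)) + l *: B (N' U (induced (Dl l) V a))).
    exact: (ac l VU Fn).
  rewrite (sharp_induced mg lcD VU Fn) (sharp_induced mg' lcD' VU Fn).
  rewrite (sharp_induced mg lcD VU Fg) (sharp_induced mg' lcD' VU Fg').
  have -> : A (induced (Dl l) V a) = A (N V a) + A (F l (l *: B (K V a))).
    by rewrite -sharpD -induced_pencil_g // subrKC.
  have -> : B (induced (Dl l) V a) = B (N' V a) - B (F l (A (K V a))).
    by rewrite -sharpB -induced_pencil_g' // subKr.
  rewrite (connectionD lcD VU (VA Fg) (VA Fl)).
  rewrite (connectionB lcD' VU (VB Fg') VBF) scalerBr.
  rewrite sharp_flat_sharpC // (connectionZ lcD' _ VU VBF).
  exact: addrACA.
move=> VX VY Fa; have [_ tD _] := lcD; have [[DV _ _ _] _ _] := lcD.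
have VXY : vector_field (lie_bracket X Y).
  by rewrite -tD //; apply: vector_fieldB; exact: DV.
have rearrange (V : lmodType R) (p q r p' q' r' s s' : V) :
    (p + l *: p' + s) - (q + l *: q' + s') - (r + l *: r') -
    (p - q - r + l *: (p' - q' - r')) = s - s'.
  have -> : p - q - r + l *: (p' - q' - r') =
      (p + l *: p') - (q + l *: q') - (r + l *: r').
    by rewrite !scalerBr (addrACA (p - q)) -opprD (addrACA p) -opprD.
  rewrite [- (_ + s')]opprD [X in X - _ - _]addrACA [X in X - _ = _]addrAC.
  by rewrite [X in X - _ = _]addrC addrK.
rewrite !sharp_curvature (step X Y VX VY Fa) (step Y X VY VX Fa) (ac l VXY Fa).
exact: rearrange.
Qed.

(** A F l B is equal to its transpose l B F A, hence self-adjoint. *)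
Lemma contract_sharp_flat_sharpC l a b : one_form a -> one_form b ->
  contract a (A (F l (l *: B b))) = contract b (A (F l (l *: B a))).
Proof.
move=> Fa Fb; rewrite [in RHS]sharp_flat_sharpC // [RHS]contractC.
by rewrite contractZl !contract_sharp // !sharpZ contractZr.
Qed.

(** The defect of [curvature_defect] is paired with all 1-forms b. *)
Lemma compatibleP : compatible g g' D D' Dl <->
  forall l a b X Y,
    one_form a -> one_form b -> vector_field X -> vector_field Y ->
    contract (K X b) (A (F l (l *: B (K Y a)))) =
    contract (K Y b) (A (F l (l *: B (K X a)))).
Proof.
have VZ l Y a : vector_field Y -> one_form a ->
    vector_field (A (F l (l *: B (K Y a)))).
  by move=> VY Fa; apply/VA/FF/vector_fieldZ/VB/FK.
split=> [[_ cR] l a b X Y Fa Fb VX VY|sym].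
  rewrite (contract_difference VX (VZ l _ _ VY Fa) Fb).
  rewrite (contract_difference VY (VZ l _ _ VX Fa) Fb).
  have := curvature_defect l VX VY Fa; rewrite (cR l X Y a VX VY Fa) subrr.
  have eq_contract (Z Z' : section M) : Z - Z' = 0 -> contract b Z = contract b Z'.
    by move=> /subr0_eq ->.
  by move=> e; apply: eq_contract; exact: esym e.
split=> // l X Y a VX VY Fa; apply: subr0_eq.
rewrite (curvature_defect l VX VY Fa) /=; apply/eqP; rewrite subr_eq0; apply/eqP.
have [[DV _ _ _] _ _] := lcD; have [[DV' _ _ _] _ _] := lcD'.
have VS U V : vector_field U -> vector_field V -> vector_field (D U V - D' U V).
  by move=> VU VV; apply: vector_fieldB; [exact: DV|exact: DV'].
apply: vector_field_eq => [||b Fb]; first exact/VS/VZ.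
  exact/VS/VZ.
have eX := contract_difference VX (VZ l _ _ VY Fa) Fb.
have eY := contract_difference VY (VZ l _ _ VX Fa) Fb.
exact: etrans (esym eX) (etrans (sym l a b X Y Fa Fb VX VY) eY).
Qed.

Definition form2_difference_sym (h : section2 M) :=
  forall a b X Y,
    one_form a -> one_form b -> vector_field X -> vector_field Y ->
    form2 h (K Y a) (K X b) = form2 h (K X a) (K Y b).

(** With l = 1, [difference_pencil_g'] gives F (B K_X a) = K_(B F X) a and
    [difference_pencil_g] gives F (A K_V a) = K_(A F V) a. For V = B A^-1 X the vector fields A F V and B F X
    agree, because A F B = B F A. *)
Lemma sharp_difference X a : vector_field X -> one_form a ->
  B (K X a) = A (K (B (sharp g X)) a).
Proof.
move=> VX Fa; have FgX := one_form_flat mg VX; have VBX := VB FgX.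
have FKa := FK VX Fa.
rewrite -(pencil_flat 1 (VB FKa)) -(pencil_flat 1 (VA (FK VBX Fa))).
congr sharp; rewrite (difference_pencil_g 1 VBX Fa).
rewrite -[B (K X a)]scale1r (difference_pencil_g' 1 VX Fa).
have := sharp_flat_sharpC 1 FgX; rewrite scale1r (sharp_flat mg VX) => ->.
by [].
Qed.

(** Given Y, the symmetry for l = 1 is used with W such that B F W = Y, for which
    A F B K_W = A K_Y. *)
Lemma compatible_form2_g : compatible g g' D D' Dl -> form2_difference_sym (dual g).
Proof.
move=> /compatibleP sym a b X Y Fa Fb VX VY; rewrite !form2E.
pose W := C 1 (sharp g' Y).
have Fg' := one_form_flat mg' VY.
have VW : vector_field W.
  by rewrite /W sharp_pencil; apply: vector_fieldD; [exact: VA|exact/vector_fieldZ/VB].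
have WY : 1 *: B (F 1 W) = Y by rewrite flat_pencil // scale1r sharp_flat.
have := sym 1 a b X W Fa Fb VX VW; rewrite (difference_pencil_g' 1 VW Fa) WY => e.
rewrite contractC {}e (contract_sharp_flat_sharpC 1 (FK VW Fb) (FK VX Fa)).
by rewrite (difference_pencil_g' 1 VW Fb) WY contract_sharp // contractC.
Qed.

(** B K_Y = A K_V with V = B A^-1 Y: the symmetry of the first form is applied to X
    and V, and B A^-1 is then moved back. *)
Lemma form2_g_form2_g' : form2_difference_sym (dual g) -> form2_difference_sym (dual g').
Proof.
move=> sym a b X Y Fa Fb VX VY; rewrite !form2E.
have VV := VB (one_form_flat mg VY).
have e := sym a b X _ Fa Fb VX VV; rewrite !form2E in e.
rewrite (sharp_difference VY Fa) {}e (contract_sharp _ _ symA) -(sharp_difference VY Fb).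
by rewrite -(contract_sharp _ _ symB).
Qed.

(** l B F A K_Y = l B K_V with V = A F Y: the symmetry of the second form is applied
    to X and V, and A F is then moved back. *)
Lemma form2_g'_compatible : form2_difference_sym (dual g') -> compatible g g' D D' Dl.
Proof.
move=> sym; apply/compatibleP => l a b X Y Fa Fb VX VY.
have VV : vector_field (A (F l Y)) by exact/VA/FF.
have e := sym a b X _ Fa Fb VX VV; rewrite !form2E in e.
have swap u v : one_form v ->
    contract u (A (F l (l *: B v))) = l *: contract u (B (F l (A v))).
  by move=> Fv; rewrite sharp_flat_sharpC // contractZr.
rewrite (swap _ _ (FK VY Fa)) (difference_pencil_g l VY Fa).
rewrite contractC {}e -(difference_pencil_g l VY Fb).
rewrite (contract_sharp_flat_sharpC l (FK VY Fb) (FK VX Fa)).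
rewrite (swap _ _ (FK VY Fb)).
by rewrite (contract_sharp _ _ symB).
Qed.

End AlmostCompatible.

Theorem theorem7 (R : realType) (n : nat) (M : smooth_manifold R n)
    (g g' : section2 M)
    (D D' : section M -> section M -> section M)
    (Dl : R -> section M -> section M -> section M)
    (metric_g : metric g) (metric_g' : metric g')
    (nondegenerate_pencil : forall l : R, nondegenerate (pencil g g' l))
    (lc_D : levi_civita g D) (lc_D' : levi_civita g' D')
    (lc_Dl : forall l : R, levi_civita (dual (pencil g g' l)) (Dl l))
    (g_g'_almost_compatible : almost_compatible g g' D D' Dl) :
  [<-> compatible g g' D D' Dl ;
       forall a b X Y : section M,
         one_form a -> one_form b -> vector_field X -> vector_field Y ->
         form2 (dual g) (induced D' Y a - induced D Y a)
                        (induced D' X b - induced D X b) =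
         form2 (dual g) (induced D' X a - induced D X a)
                        (induced D' Y b - induced D Y b) ;
       forall a b X Y : section M,
         one_form a -> one_form b -> vector_field X -> vector_field Y ->
         form2 (dual g') (induced D' Y a - induced D Y a)
                         (induced D' X b - induced D X b) =
         form2 (dual g') (induced D' X a - induced D X a)
                         (induced D' Y b - induced D Y b) ].
Proof.
tfae.
- exact: compatible_form2_g.
- exact: (@form2_g_form2_g' R n M g g' D D' Dl).
- exact: form2_g'_compatible.
Qed.
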